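(* Let $n,\kappa$ be integers with $1\le\kappa<n$, let $\bm Q\in\mathbb{R}^{n\times n}$ be symmetric positive semidefinite, $\bm c\in\mathbb{R}^n$, $\tau>0$, $\bm A\in\mathbb{R}^{m_1\times n}$, $\bm b\in\mathbb{R}^{m_1}$, $\bm W\in\mathbb{R}^{m_2\times n}$, $\bm h\in\mathbb{R}^{m_2}$. Consider the mixed-binary problem (P), its convex relaxation (R) and the Fenchel dual (D) of (R) given in the context, and assume (R) is feasible. Let $f_{\mathrm{LB}}$ be the optimal objective value of (R), and let $f_{\mathrm{UB}}\in\mathbb{R}$ be a valid upper bound on the optimal objective value of (P). Let $\hat{\bm p}$ be an optimal solution of (D), let $\delta_i=\frac{\tau}{4}\hat p_i^{\,2}$ ($i\in[n]$) be the corresponding screening scores, let $\sigma:[n]\to[n]$ be a permutation with $\delta_{\sigma(1)}\ge\delta_{\sigma(2)}\ge\cdots\ge\delta_{\sigma(n)}$ (ties ordered arbitrarily), and let $\mathcal S_\kappa=\{\sigma(j)\mid j\in[\kappa]\}$ and $\mathcal S_\kappa^c=[n]\setminus\mathcal S_\kappa$. Define $$\mathcal I_0:=\{\,i\in\mathcal S_\kappa^c \mid f_{\mathrm{LB}}+\delta_{\sigma(\kappa)}-\delta_i>f_{\mathrm{UB}}\,\},\qquad \mathcal I_1:=\{\,i\in\mathcal S_\kappa \mid f_{\mathrm{LB}}+\delta_i-\delta_{\sigma(\kappa+1)}>f_{\mathrm{UB}}\,\}.$$ Then every optimal solution $(\bm x^\star,\bm z^\star)$ of (P) satisfies $z_i^\star=0$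 for all $i\in\mathcal I_0$ and $z_i^\star=1$ for all $i\in\mathcal I_1$.
   Context: Notation: $[n]=\{1,\dots,n\}$; $\bm 1$ is the all-ones vector; vector inequalities are componentwise. Problem (P) (cardinality-constrained portfolio optimization in mixed-binary form): minimize over $(\bm x,\bm z)$ $$\tfrac12\bm x^\top\bm Q\bm x+\bm c^\top\bm x+\tau\|\bm x\|_2^2$$ subject to $\bm A\bm x=\bm b$, $\bm W\bm x\ge\bm h$, $\sum_{i=1}^n z_i\le\kappa$, the implication $z_i=0\Rightarrow x_i=0$ for all $i\in[n]$, $\bm x\in\mathbb{R}^n$ and $\bm z\in\{0,1\}^n$. Perspective function: $\phi(x,z)=x^2/z$ if $z>0$; $\phi(0,0)=0$; $\phi(x,0)=+\infty$ if $x\ne0$. Feasible sets: $\mathcal X=\{\bm x\in\mathbb{R}^n\mid \bm A\bm x=\bm b,\ \bm W\bm x\ge\bm h\}$, $\mathcal Z=\{\bm z\in[0,1]^n\mid \bm 1^\top\bm z\le\kappa\}$, $\mathcal F=\mathcal X\times\mathcal Z$. Problem (R) (convex perspective relaxation of (P)): minimize $\tfrac12\bm x^\top\bm Q\bm x+\bm c^\top\bm x+\tau\sum_{i=1}^n\phi(x_i,z_i)$ over $(\bm x,\bm z)\in\mathcal F$. Problem (D) (Fenchel dual of (R)): with $$\mathcal L_F(\bm x,\bm z,\bm p)=\tfrac12\bm x^\top\bm Q\bm x+\bm c^\top\bm x+\tau\sum_{i=1}^n\Big(p_ix_i-\frac{p_i^2}{4}z_i\Big),$$ (D) is $\max_{\bm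 p\in\mathbb{R}^n}\ \min_{(\bm x,\bm z)\in\mathcal F}\mathcal L_F(\bm x,\bm z,\bm p)$. Strong duality holds between (R) and (D), i.e. the optimal value of (D) equals $f_{\mathrm{LB}}$, and both optima are attained. Screening scores: $\delta_i:=\frac{\tau}{4}\hat p_i^{\,2}$. Equivalently, if $(\hat{\bm x},\hat{\bm z})$ is an optimal solution of (R), and $\hat{\bm\lambda}\in\mathbb{R}^{m_1}$, $\hat{\bm\nu}\in\mathbb{R}^{m_2}_{+}$ are Lagrange multipliers for $\bm A\bm x=\bm b$ and $\bm W\bm x\ge\bm h$ satisfying the KKT conditions at $\hat{\bm x}$ of the problem $\min_{\bm x\in\mathcal X}\tfrac12\bm x^\top\bm Q\bm x+\bm c^\top\bm x+\tau\hat{\bm p}^\top\bm x$ (with Lagrangian $\tfrac12\bm x^\top\bm Q\bm x+\bm c^\top\bm x+\tau\hat{\bm p}^\top\bm x+\bm\lambda^\top(\bm A\bm x-\bm b)-\bm\nu^\top(\bm W\bm x-\bm h)$), then $\hat{\bm p}=-\frac1\tau(\bm Q\hat{\bm x}+\bm c+\bm A^\top\hat{\bm\lambda}-\bm W^\top\hat{\bm\nu})$ and $$\delta_i=\frac1{4\tau}\big[\bm Q\hat{\bm x}+\bm c+\bm A^\top\hat{\bm\lambda}-\bm W^\top\hat{\bm\nu}\big]_i^2 .$$ A valid upper bound on (P) means a real number $f_{\mathrm{UB}}\ge f^\star$, where $f^\star$ is the optimal objective value of (P) (for instance the objective value of any feasible solution of (P)). *)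

(* Defs.v *)
From HB Require Import structures.
From mathcomp Require Import all_boot all_order all_algebra all_fingroup.
From mathcomp Require Import all_classical all_reals ereal.

Set Implicit Arguments.
Unset Strict Implicit.
Unset Printing Implicit Defensive.

Import Order.TTheory GRing.Theory Num.Theory.

Local Open Scope classical_set_scope.
Local Open Scope ring_scope.

Section Optimization.
Variables (R : realType) (T : Type).
Implicit Types (D : set T) (f : T -> \bar R).

(* Optimal values live in \bar R: +oo for an infeasible minimization problem,
   -oo for one that is unbounded below. *)
Definition min_value D f : \bar R := ereal_inf (f @` D).

Definition is_minimizer D f (s : T) : Prop :=
  D s /\ forall t, D t -> (f s <= f t)%E.

Definition is_maximizer D f (s : T) : Prop :=
  D s /\ forall t, D t -> (f t <= f s)%E.

End Optimization.

Section Problems.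
Variable R : realType.

Definition sym_psd n (Q : 'M[R]_n) : Prop :=
  Q^T = Q /\ forall x : 'cV[R]_n, 0 <= (x^T *m Q *m x) 0 0.

Definition quad_obj n (Q : 'M[R]_n) (c : 'cV[R]_n) (x : 'cV[R]_n) : R :=
  2^-1 * (x^T *m Q *m x) 0 0 + (c^T *m x) 0 0.

(* The value at z < 0, never used on the feasible sets below, is set to +oo. *)
Definition persp (x z : R) : \bar R :=
  if 0 < z then (x ^+ 2 / z)%:E
  else if (x == 0) && (z == 0) then 0%E else +oo%E.

Definition Xset n m1 m2 (A : 'M[R]_(m1, n)) (b : 'cV[R]_m1)
    (W : 'M[R]_(m2, n)) (h : 'cV[R]_m2) : set 'cV[R]_n :=
  [set x : 'cV[R]_n | A *m x = b /\ forall i, h i 0 <= (W *m x) i 0].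

Definition Zset n (kappa : nat) : set 'cV[R]_n :=
  [set z : 'cV[R]_n | (forall i, 0 <= z i 0 <= 1) /\ \sum_i z i 0 <= kappa%:R].

Definition feasR n m1 m2 (A : 'M[R]_(m1, n)) (b : 'cV[R]_m1)
    (W : 'M[R]_(m2, n)) (h : 'cV[R]_m2) (kappa : nat) :
    set ('cV[R]_n * 'cV[R]_n) :=
  Xset A b W h `*` @Zset n kappa.

Definition objR n (Q : 'M[R]_n) (c : 'cV[R]_n) (tau : R)
    (s : 'cV[R]_n * 'cV[R]_n) : \bar R :=
  ((quad_obj Q c s.1)%:E + tau%:E * \sum_i persp (s.1 i 0%R) (s.2 i 0%R))%E.

Definition feasP n m1 m2 (A : 'M[R]_(m1, n)) (b : 'cV[R]_m1)
    (W : 'M[R]_(m2, n)) (h : 'cV[R]_m2) (kappa : nat) :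
    set ('cV[R]_n * 'cV[R]_n) :=
  [set s : 'cV[R]_n * 'cV[R]_n |
    [/\ Xset A b W h s.1,
        \sum_i s.2 i 0 <= kappa%:R,
        forall i, s.2 i 0 = 0 -> s.1 i 0 = 0
      & forall i, s.2 i 0 = 0 \/ s.2 i 0 = 1]].

Definition objP n (Q : 'M[R]_n) (c : 'cV[R]_n) (tau : R)
    (s : 'cV[R]_n * 'cV[R]_n) : \bar R :=
  (quad_obj Q c s.1 + tau * \sum_i s.1 i 0 ^+ 2)%:E.

Definition fenchel_lagr n (Q : 'M[R]_n) (c : 'cV[R]_n) (tau : R)
    (p : 'cV[R]_n) (s : 'cV[R]_n * 'cV[R]_n) : R :=
  quad_obj Q c s.1
  + tau * \sum_i (p i 0 * s.1 i 0 - p i 0 ^+ 2 / 4 * s.2 i 0).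

Definition dual_obj n m1 m2 (Q : 'M[R]_n) (c : 'cV[R]_n) (tau : R)
    (A : 'M[R]_(m1, n)) (b : 'cV[R]_m1)
    (W : 'M[R]_(m2, n)) (h : 'cV[R]_m2) (kappa : nat)
    (p : 'cV[R]_n) : \bar R :=
  min_value (feasR A b W h kappa) (fun s => (fenchel_lagr Q c tau p s)%:E).

Definition score n (tau : R) (p : 'cV[R]_n) (i : 'I_n) : R :=
  tau / 4 * p i 0 ^+ 2.

(* Positions in 'I_n start at 0, so the first kappa positions are j < kappa. *)
Definition top_set n (kappa : nat) (sigma : {perm 'I_n}) : set 'I_n :=
  [set sigma j | j in [set j : 'I_n | (j < kappa)%N]].

(* pos_last and pos_next are the 0-based positions of the kappa-th and
   (kappa+1)-th entries. *)
Definition pos_last n kappa (kn : (kappa < n)%N) : 'I_n :=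
  Ordinal (leq_ltn_trans (leq_pred kappa) kn).

Definition pos_next n kappa (kn : (kappa < n)%N) : 'I_n := Ordinal kn.

Definition screen0 n kappa (kn : (kappa < n)%N) (sigma : {perm 'I_n})
    (delta : 'I_n -> R) (fLB : \bar R) (fUB : R) : set 'I_n :=
  [set i | (~` top_set kappa sigma) i /\
    (fUB%:E < fLB + (delta (sigma (pos_last kn)))%:E - (delta i)%:E)%E].

Definition screen1 n kappa (kn : (kappa < n)%N) (sigma : {perm 'I_n})
    (delta : 'I_n -> R) (fLB : \bar R) (fUB : R) : set 'I_n :=
  [set i | top_set kappa sigma i /\
    (fUB%:E < fLB + (delta i)%:E - (delta (sigma (pos_next kn)))%:E)%E].

End Problems.

(* Main.v *)
Require Import Defs.
From HB Require Import structures.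
From mathcomp Require Import all_boot all_order all_algebra all_fingroup.
From mathcomp Require Import all_classical all_reals ereal.
From mathcomp Require Import topology normedtype derive.
From mathcomp Require Import ring lra.

Set Implicit Arguments.
Unset Strict Implicit.
Unset Printing Implicit Defensive.

Import Order.TTheory GRing.Theory Num.Theory.
Import numFieldNormedType.Exports.

Local Open Scope classical_set_scope.
Local Open Scope ring_scope.

(** Screening rests on weak duality.  For a feasible point (x, z) of the
mixed-binary problem, the Fenchel Lagrangian at the dual solution p is at most
the objective at x, and it is separable:
  L(x, z, p) = q(x) + tau p^T x - sum_i delta_i z_i.
Replacing z by the indicator of the kappa largest scores, with x kept, gives a
feasible point of the relaxation, whose Lagrangian is therefore at least the
dual optimum.  Hence the objective at x exceeds the dual optimum by at least
the loss sum_(i in S) delta_i - sum_i delta_i z_i, and [knapsack_gap] bounds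
this loss below by |delta_i - theta| as soon as z disagrees with the indicator
of S at i, for any threshold theta separating the scores in S from the others.
Taking theta = delta_(sigma(kappa+1)) or theta = delta_(sigma(kappa)) makes
the objective exceed fUB whenever z_i violates one of the two screening rules.

It remains to know that the dual optimum is at least fLB ([strong_duality]).
The obstacle is that the perspective function is neither finite nor smooth at
z = 0.  So the relaxation is first solved on the set where every z_i >= e, with
e > 0 ([persp_obj_minimizer], by compactness of sublevel sets).  There the
objective is differentiable in z, and p = 2 x / z at the minimizer turns the
Lagrangian into a convex function touching the objective at the minimizer to
first order, so the Lagrangian is minimized at the same point
([fenchel_lagr_minimizer]).  Pulling an arbitrary z slightly towards the
constant vector kappa / n puts it above the floor e, and costs an amount that
tends to 0 with e because the perspective terms at the minimizer are bounded
independently of e ([duality_gap_le]).  Thus the dual has values arbitrarily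
close to fLB, and a maximizer of the dual does at least as well. *)

(** * The cost of deviating from the largest scores *)

(** Both factors of (d j - th) * ([j in S] - z j) have the same sign, so the sum
over j of these products dominates each single one.  The loss
sum_(j in S) d j - sum_j d j * z j is that sum plus th times the unused budget
#|S| - sum_j z j, both nonnegative. *)
Lemma knapsack_gap (R : realType) (I : finType) (S : {set I}) (d z : I -> R)
    (th : R) :
  0 <= th ->
  (forall j, j \in S -> th <= d j) -> (forall j, j \notin S -> d j <= th) ->
  (forall j, 0 <= z j <= 1) -> \sum_j z j <= #|S|%:R ->
  forall i, \sum_j d j * z j + `|d i - th| * `|(i \in S)%:R - z i|
    <= \sum_(j in S) d j.
Proof.
move=> th0 dS dNS z01 zS i.
have gapE j : (d j - th) * ((j \in S)%:R - z j)
    = `|d j - th| * `|(j \in S)%:R - z j|.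
  have /andP[z0 z1] := z01 j; rewrite -normrM ger0_norm//.
  case: (boolP (j \in S)) => [/dS|/dNS] dj /=; last by nra.
  by apply: mulr_ge0; lra.
have : \sum_j (d j - th) * ((j \in S)%:R - z j)
    >= `|d i - th| * `|(i \in S)%:R - z i|.
  under eq_bigr do rewrite gapE.
  by rewrite (bigD1 i)//= lerDl; apply: sumr_ge0 => j _; exact: mulr_ge0.
have cardE : \sum_j (j \in S)%:R = #|S|%:R :> R.
  rewrite -sum1_card natr_sum [RHS]big_mkcond.
  by apply: eq_bigr => j _; case: ifP.
have dSE : \sum_(j in S) d j = \sum_j d j * (j \in S)%:R.
  rewrite [LHS]big_mkcond; apply: eq_bigr => j _.
  by case: ifP; rewrite ?mulr1 ?mulr0.
have -> : \sum_j (d j - th) * ((j \in S)%:R - z j) =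
    \sum_(j in S) d j - \sum_j d j * z j - th * (#|S|%:R - \sum_j z j).
  rewrite dSE -cardE -!sumrB mulr_sumr -sumrB.
  by apply: eq_bigr => j _; ring.
have : 0 <= th * (#|S|%:R - \sum_j z j) by apply: mulr_ge0; lra.
lra.
Qed.

(** * Continuity and compactness for column vectors *)

Section ColumnTopology.
Variable R : realType.

Lemma continuous_sum (T : topologicalType) (I : Type) (r : seq I)
    (f : I -> T -> R) (s : T) :
  (forall i, {for s, continuous (f i)}) ->
  {for s, continuous (fun x => \sum_(i <- r) f i x)}.
Proof.
move=> fc; apply: (@cvg_big _ _ _ _ predT) => //; last by move=> i _; exact: fc.
by move=> x; exact: add_continuous.
Qed.

Lemma continuous_add (T : topologicalType) (f g : T -> R) (s : T) :
  {for s, continuous f} -> {for s, continuous g} ->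
  {for s, continuous (fun x => f x + g x)}.
Proof. exact: continuousD. Qed.

Lemma continuous_mul (T : topologicalType) (f g : T -> R) (s : T) :
  {for s, continuous f} -> {for s, continuous g} ->
  {for s, continuous (fun x => f x * g x)}.
Proof. exact: continuousM. Qed.

Lemma trmx_continuous p q : continuous (@trmx R p q).
Proof.
move=> M s /= /nbhs_ballP[e e0 es]; apply/nbhs_ballP; exists e => //= N [_ MN].
by apply: es; split=> // i j; rewrite !mxE; exact: MN.
Qed.

Lemma compact_cV_box (k : nat) (u v : R) :
  compact [set x : 'cV[R]_k | forall i, u <= x i 0 <= v].
Proof.
have -> : [set x : 'cV[R]_k | forall i, u <= x i 0 <= v] =
    (fun y : 'rV[R]_k => y^T) @`
      [set y : 'rV[R]_k | forall i, `[u, v]%classic (y ord0 i)].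
  apply/seteqP; split=> [x xb|_ [y yb <-] i]; last first.
    by rewrite mxE; have := yb i; rewrite /= in_itv.
  exists x^T; rewrite ?trmxK// => i.
  by rewrite /= mxE in_itv; exact: xb.
apply: continuous_compact; last first.
  apply: (@rV_compact R k (fun=> `[u, v]%classic)) => i.
  exact: segment_compact.
by apply: continuous_subspaceT; exact: trmx_continuous.
Qed.

Lemma continuous_mulmx_coord (k l : nat) (M : 'M[R]_(k, l)) i (x : 'cV[R]_l) :
  {for x, continuous (fun x : 'cV[R]_l => (M *m x) i 0)}.
Proof.
have -> : (fun x : 'cV[R]_l => (M *m x) i 0) = fun x => \sum_j M i j * x j 0.
  by apply/funext => y; rewrite mxE.
apply: continuous_sum => j; apply: continuous_mul; first exact: cst_continuous.
exact: coord_continuous.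
Qed.

End ColumnTopology.

(** * Objective of the relaxation and Fenchel Lagrangian *)

Definition segment_pt (R : realType) (V : lmodType R) (t : R) (u v : V) : V :=
  (1 - t) *: u + t *: v.

Section Relaxation.
Variables (R : realType) (n m1 m2 : nat).
Variables (Q : 'M[R]_n) (c : 'cV[R]_n) (tau : R).
Variables (A : 'M[R]_(m1, n)) (b : 'cV[R]_m1).
Variables (W : 'M[R]_(m2, n)) (h : 'cV[R]_m2).
Hypotheses (Qpsd : sym_psd Q) (tau_gt0 : 0 < tau).

Lemma quad_obj_convex (t : R) (x y : 'cV[R]_n) : 0 <= t <= 1 ->
  quad_obj Q c (segment_pt t x y)
    <= (1 - t) * quad_obj Q c x + t * quad_obj Q c y.
Proof.
case/andP=> t0 t1; have := Qpsd.2 (x - y).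
rewrite /quad_obj /segment_pt !linearD/= !linearN/= !linearZ/=.
rewrite !mulmxDl !mulNmx -!scalemxAl.
move: (x^T *m Q *m x) (y^T *m Q *m x) (x^T *m Q *m y) (y^T *m Q *m y).
move: (c^T *m x) (c^T *m y) => cx cy bxx byx bxy byy; rewrite !mxE => b0.
have : 0 <= t * (1 - t) by apply: mulr_ge0; lra.
nra.
Qed.

Lemma Xset_convex (t : R) (x y : 'cV[R]_n) : 0 <= t <= 1 ->
  Xset A b W h x -> Xset A b W h y -> Xset A b W h (segment_pt t x y).
Proof.
case/andP=> t0 t1 [Ax Wx] [Ay Wy]; split=> [|i].
  by rewrite mulmxDr !linearZ/= Ax Ay -scalerDl subrK scale1r.
rewrite mulmxDr !linearZ/= !mxE.
have := Wx i; have := Wy i; rewrite !mxE; nra.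
Qed.

(** Real-valued form of the relaxed objective, faithful only where every z_i is
positive, see [objR_persp_obj]. *)
Definition persp_obj (s : 'cV[R]_n * 'cV[R]_n) : R :=
  quad_obj Q c s.1 + tau * \sum_i s.1 i 0 ^+ 2 / s.2 i 0.

Lemma objR_persp_obj (s : 'cV[R]_n * 'cV[R]_n) : (forall i, 0 < s.2 i 0) ->
  objR Q c tau s = (persp_obj s)%:E.
Proof.
move=> s0; rewrite /objR /persp_obj EFinD EFinM.
by under eq_bigr do rewrite /persp s0; rewrite sumEFin.
Qed.

(** Completing the square, x^2 / z = p x - p^2 z / 4 + (x - p z / 2)^2 / z.  The
gap between objective and Lagrangian is quadratic in the residual x - p z / 2,
which is what makes the Lagrangian tangent to the objective where it vanishes.
*)
Lemma persp_obj_fenchel (p : 'cV[R]_n) (s : 'cV[R]_n * 'cV[R]_n) :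
  (forall i, 0 < s.2 i 0) ->
  persp_obj s = fenchel_lagr Q c tau p s
    + tau * \sum_i (s.1 i 0 - p i 0 / 2 * s.2 i 0) ^+ 2 / s.2 i 0.
Proof.
move=> s0; rewrite /persp_obj /fenchel_lagr.
move: (quad_obj _ _ _) => q; rewrite -addrA -mulrDr -big_split/=.
congr (_ + _ * _); apply: eq_bigr => i _.
by field; rewrite gt_eqF.
Qed.

(** For z_i = 1 this is p x - p^2 / 4 <= x^2; for z_i = 0 both terms vanish
since then x_i = 0. *)
Lemma fenchel_lagr_objP (p : 'cV[R]_n) (kappa : nat)
    (s : 'cV[R]_n * 'cV[R]_n) :
  feasP A b W h kappa s ->
  fenchel_lagr Q c tau p s <= quad_obj Q c s.1 + tau * \sum_i s.1 i 0 ^+ 2.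
Proof.
case=> _ _ s0 s01; rewrite lerD2l ler_pM2l//; apply: ler_sum => i _.
case: (s01 i) => si; last first.
  by rewrite si; have := sqr_ge0 (s.1 i 0 - p i 0 / 2); nra.
by rewrite si s0// !mulr0 subr0 expr0n.
Qed.

Lemma fenchel_lagr_convex (p : 'cV[R]_n) (t : R) (u v : 'cV[R]_n * 'cV[R]_n) :
  0 <= t <= 1 ->
  fenchel_lagr Q c tau p (segment_pt t u v)
  <= (1 - t) * fenchel_lagr Q c tau p u + t * fenchel_lagr Q c tau p v.
Proof.
move=> t01; have := quad_obj_convex u.1 v.1 t01.
rewrite /fenchel_lagr !mulrDr /=.
set qu := quad_obj Q c u.1; set qv := quad_obj Q c v.1.
set q := quad_obj Q c _ => qle.
rewrite (_ : \sum_i _ =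
  (1 - t) * \sum_i (p i 0 * u.1 i 0 - p i 0 ^+ 2 / 4 * u.2 i 0)
  + t * \sum_i (p i 0 * v.1 i 0 - p i 0 ^+ 2 / 4 * v.2 i 0)); last first.
  rewrite !mulr_sumr -big_split/=; apply: eq_bigr => i _.
  by rewrite !mxE; ring.
rewrite /q /segment_pt/= in qle *.
lra.
Qed.

(** Half of the perspective term absorbs the linear term c^T x, because
x^2 / z >= x^2 on z <= 1.  So a bound on the objective bounds x and the
perspective sum, whatever the lower bound on z is. *)
Lemma persp_obj_lower (s : 'cV[R]_n * 'cV[R]_n) :
  (forall i, 0 < s.2 i 0 <= 1) ->
  tau / 2 * (\sum_i s.1 i 0 ^+ 2 / s.2 i 0) - \sum_i c i 0 ^+ 2 / (2 * tau)
    <= persp_obj s.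
Proof.
move=> s01; rewrite /persp_obj /quad_obj.
have := Qpsd.2 s.1; set q := (_ *m s.1) _ _ => q0.
rewrite mxE; set S := \sum_i s.1 i 0 ^+ 2 / s.2 i 0.
suff : 0 <= \sum_i (c^T 0 i * s.1 i 0) + tau / 2 * S
             + \sum_i c i 0 ^+ 2 / (2 * tau) by lra.
rewrite mulr_sumr -!big_split/=; apply: sumr_ge0 => i _.
have /andP[z0 z1] := s01 i; rewrite mxE.
have xz : s.1 i 0 ^+ 2 <= s.1 i 0 ^+ 2 / s.2 i 0.
  by rewrite ler_pdivlMr// ler_piMr// sqr_ge0.
have sq : 0 <= (tau * s.1 i 0 + c i 0) ^+ 2 / (2 * tau).
  by rewrite divr_ge0 ?sqr_ge0// mulr_ge0 ?ltW.
have sqE : (tau * s.1 i 0 + c i 0) ^+ 2 / (2 * tau) =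
  c i 0 * s.1 i 0 + tau / 2 * s.1 i 0 ^+ 2 + c i 0 ^+ 2 / (2 * tau).
  by field; rewrite gt_eqF.
have : tau / 2 * s.1 i 0 ^+ 2 <= tau / 2 * (s.1 i 0 ^+ 2 / s.2 i 0).
  by rewrite ler_pM2l// divr_gt0.
lra.
Qed.

(** * Minimizers of the relaxation away from z = 0 *)

Definition Zfloor (kappa : nat) (e : R) : set 'cV[R]_n :=
  @Zset R n kappa `&` [set z | forall i, e <= z i 0].

Lemma continuous_quad_obj (x : 'cV[R]_n) : {for x, continuous (quad_obj Q c)}.
Proof.
have -> : quad_obj Q c = fun x => 2^-1 * \sum_j x j 0 * (Q *m x) j 0
    + \sum_j c j 0 * x j 0.
  apply/funext => y; rewrite /quad_obj -mulmxA !mxE.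
  by congr (_ * _ + _); apply: eq_bigr => j _; rewrite mxE.
apply: continuous_add; first apply: continuous_mul; first exact: cst_continuous.
  apply: continuous_sum => j; apply: continuous_mul.
    exact: coord_continuous.
  exact: continuous_mulmx_coord.
apply: continuous_sum => j; apply: continuous_mul; first exact: cst_continuous.
exact: coord_continuous.
Qed.

Lemma closed_Xset : closed (Xset A b W h).
Proof.
have -> : Xset A b W h =
    \bigcap_i ((fun x => (A *m x) i 0) @^-1` [set y | y = b i 0])
    `&` \bigcap_i ((fun x => (W *m x) i 0) @^-1` [set y | h i 0 <= y]).
  apply/seteqP; split=> x [Ax Wx]; split.
  - by move=> i _; rewrite /= Ax.
  - by move=> i _; exact: Wx.
  - by apply/colP => j; exact: Ax.
  - by move=> i; exact: Wx.
by apply: closedI; apply: closed_bigI => i _; apply: preimage_closed;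
  do ?[exact: closed_eq|exact: closed_ge] => x _; exact: continuous_mulmx_coord.
Qed.

Lemma Zset_convex (kappa : nat) (t : R) (z w : 'cV[R]_n) : 0 <= t <= 1 ->
  Zset kappa z -> Zset kappa w -> Zset kappa (segment_pt t z w).
Proof.
case/andP=> t0 t1 [z01 zk] [w01 wk]; split=> [i|].
  have /andP[zi0 zi1] := z01 i; have /andP[wi0 wi1] := w01 i.
  by rewrite !mxE; apply/andP; split; nra.
under eq_bigr do rewrite !mxE.
rewrite big_split/= -!mulr_sumr; nra.
Qed.

Lemma Zfloor_convex (kappa : nat) (e t : R) (z w : 'cV[R]_n) : 0 <= t <= 1 ->
  Zfloor kappa e z -> Zfloor kappa e w -> Zfloor kappa e (segment_pt t z w).
Proof.
move=> t01 [zk ze] [wk we]; split; first exact: Zset_convex.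
case/andP: t01 => t0 t1 i; rewrite !mxE.
have := ze i; have := we i; nra.
Qed.

Lemma closed_Zfloor (kappa : nat) (e : R) : closed (Zfloor kappa e).
Proof.
have -> : Zfloor kappa e =
    (\bigcap_i ((fun x : 'cV[R]_n => x i 0) @^-1` [set y | 0 <= y])
     `&` \bigcap_i ((fun x : 'cV[R]_n => x i 0) @^-1` [set y | y <= 1]))
    `&` ((fun x : 'cV[R]_n => \sum_i x i 0) @^-1` [set y | y <= kappa%:R]
     `&` \bigcap_i ((fun x : 'cV[R]_n => x i 0) @^-1` [set y | e <= y])).
  apply/seteqP; split=> x.
    move=> [[x01 xk] xe]; split; split=> //.
    - by move=> i _; have /andP[] := x01 i.
    - by move=> i _; have /andP[] := x01 i.
    - by move=> i _; exact: xe.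
  move=> [[x0 x1] [xk xe]]; split; [split=> //|]; move=> i; last exact: xe.
  by apply/andP; split; [exact: x0|exact: x1].
do !apply: closedI; do ?[apply: closed_bigI => i _]; apply: preimage_closed;
  do ?[exact: closed_le|exact: closed_ge] => x _; do ?exact: coord_continuous.
by apply: continuous_sum => i; exact: coord_continuous.
Qed.

Lemma continuous_persp_obj (s : 'cV[R]_n * 'cV[R]_n) :
  (forall i, 0 < s.2 i 0) -> {for s, continuous persp_obj}.
Proof.
move=> s0.
have fstc i : {for s, continuous (fun s : 'cV[R]_n * 'cV[R]_n => s.1 i 0)}.
  by apply: (@cvg_comp _ _ _ fst (fun x : 'cV[R]_n => x i 0));
    [exact: cvg_fst|exact: coord_continuous].
have sndc i : {for s, continuous (fun s : 'cV[R]_n * 'cV[R]_n => s.2 i 0)}.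
  by apply: (@cvg_comp _ _ _ snd (fun x : 'cV[R]_n => x i 0));
    [exact: cvg_snd|exact: coord_continuous].
apply: continuous_add.
  by apply: (@cvg_comp _ _ _ fst (quad_obj Q c));
    [exact: cvg_fst|exact: continuous_quad_obj].
apply: continuous_mul; first exact: cst_continuous.
apply: continuous_sum => i; apply: continuous_mul.
  by apply: continuous_mul; exact: fstc.
by apply: continuousV; [rewrite gt_eqF|exact: sndc].
Qed.

(** By [persp_obj_lower], the points at least as good as s0 lie in a box,
hence in a compact set on which the objective is continuous. *)
Lemma persp_obj_minimizer (kappa : nat) (e : R) (s0 : 'cV[R]_n * 'cV[R]_n) :
  0 < e -> Xset A b W h s0.1 -> Zfloor kappa e s0.2 ->
  exists s, [/\ Xset A b W h s.1, Zfloor kappa e s.2 &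
    forall s', Xset A b W h s'.1 -> Zfloor kappa e s'.2 ->
      persp_obj s <= persp_obj s'].
Proof.
move=> e0 Xs0 Zs0.
have z01 z : Zfloor kappa e z -> forall i, 0 < z i 0 <= 1.
  move=> [[z01 _] ze] i; move/andP: (z01 i) => [_ ->].
  by rewrite (lt_le_trans e0).
pose B := 2 / tau * (persp_obj s0 + \sum_i c i 0 ^+ 2 / (2 * tau)).
pose K := ([set x : 'cV[R]_n | forall i, - (B + 1) <= x i 0 <= B + 1]
  `&` Xset A b W h) `*` Zfloor kappa e.
(* x_i^2 <= B gives |x_i| <= B + 1, which avoids square roots. *)
have sublevel s : Xset A b W h s.1 -> Zfloor kappa e s.2 ->
    persp_obj s <= persp_obj s0 -> K s.
  move=> Xs Zs ss0; split=> //; split=> // i.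
  have sB : s.1 i 0 ^+ 2 <= B.
    have := persp_obj_lower (z01 _ Zs).
    set S := \sum_i s.1 i 0 ^+ 2 / s.2 i 0 => low.
    have SB : S <= B.
      have -> : S = 2 / tau * (tau / 2 * S) by field; rewrite gt_eqF.
      by rewrite ler_pM2l ?divr_gt0//; lra.
    have /andP[zi0 zi1] := z01 _ Zs i.
    apply: le_trans SB; rewrite /S (bigD1 i)//=.
    have : 0 <= \sum_(j < n | j != i) s.1 j 0 ^+ 2 / s.2 j 0.
      apply: sumr_ge0 => j _; have /andP[zj0 _] := z01 _ Zs j.
      by rewrite divr_ge0 ?sqr_ge0 ?ltW.
    have : s.1 i 0 ^+ 2 <= s.1 i 0 ^+ 2 / s.2 i 0.
      by rewrite ler_pdivlMr// ler_piMr// sqr_ge0.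
    lra.
  have B0 : 0 <= B := le_trans (sqr_ge0 _) sB.
  by apply/andP; split; nra.
have K0 : K !=set0 by exists s0; exact: sublevel.
have Kc : compact K.
  apply: compact_setX.
    by apply: compact_closedI; [exact: compact_cV_box|exact: closed_Xset].
  have -> : Zfloor kappa e =
      [set z : 'cV[R]_n | forall i, 0 <= z i 0 <= 1] `&` Zfloor kappa e.
    by apply/seteqP; split=> [z Zz|z []//]; split=> //; exact: Zz.1.1.
  by apply: compact_closedI; [exact: compact_cV_box|exact: closed_Zfloor].
have fc : {within K, continuous persp_obj}.
  apply: continuous_in_subspaceT => s /set_mem[_ Zs].
  by apply: continuous_persp_obj => i; have /andP[] := z01 _ Zs i.
have [s /set_mem[[_ Xs] Zs] smin] := compact_EVT_min K0 Kc fc.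
exists s; split=> // s' Xs' Zs'.
have [s's0|/ltW s0s'] := leP (persp_obj s') (persp_obj s0).
  by apply/smin/mem_set/sublevel.
by apply: le_trans s0s'; apply/smin/mem_set/sublevel.
Qed.

(** * Strong duality *)

(** The derivative in x of the perspective function; it makes the residual in
[persp_obj_fenchel] vanish at s. *)
Definition grad_persp (s : 'cV[R]_n * 'cV[R]_n) : 'cV[R]_n :=
  \col_i (2 * s.1 i 0 / s.2 i 0).

Lemma fenchel_lagr_grad (s : 'cV[R]_n * 'cV[R]_n) : (forall i, 0 < s.2 i 0) ->
  fenchel_lagr Q c tau (grad_persp s) s = persp_obj s.
Proof.
move=> s0; rewrite (persp_obj_fenchel (grad_persp s) s0).
rewrite [X in tau * X]big1 ?mulr0 ?addr0// => i _; rewrite mxE.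
by field; rewrite gt_eqF.
Qed.

(** Along the segment from s to u the residual at parameter t is t times that at
u, so the objective stays within t^2 K of the Lagrangian.  Minimality of s and
convexity of the Lagrangian then give L(s) <= L(u) + t K for every t > 0. *)
Lemma fenchel_lagr_minimizer (kappa : nat) (e : R) (s u : 'cV[R]_n * 'cV[R]_n) :
  0 < e ->
  Xset A b W h s.1 -> Zfloor kappa e s.2 ->
  (forall s', Xset A b W h s'.1 -> Zfloor kappa e s'.2 ->
    persp_obj s <= persp_obj s') ->
  Xset A b W h u.1 -> Zfloor kappa e u.2 ->
  persp_obj s <= fenchel_lagr Q c tau (grad_persp s) u.
Proof.
move=> e0 Xs Zs smin Xu Zu.
have pos z : Zfloor kappa e z -> forall i, 0 < z i 0.
  by move=> [_ ze] i; exact: lt_le_trans (ze i).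
set p := grad_persp s.
(* t * r i is the residual at segment_pt t s u, where z_i >= e. *)
pose r i := (u.1 i 0 - s.1 i 0) - p i 0 / 2 * (u.2 i 0 - s.2 i 0).
pose K := tau * \sum_i r i ^+ 2 / e.
have K0 : 0 <= K.
  apply: mulr_ge0; first exact: ltW.
  by apply: sumr_ge0 => i _; rewrite divr_ge0 ?sqr_ge0 ?ltW.
have step t : 0 < t <= 1 ->
    persp_obj s <= fenchel_lagr Q c tau p u + t * K.
  case/andP=> t0 t1.
  have t01 : 0 <= t <= 1 by rewrite (ltW t0).
  pose v := segment_pt t s u.
  have Xv : Xset A b W h v.1 by exact: Xset_convex.
  have Zv : Zfloor kappa e v.2 by exact: Zfloor_convex.
  have := smin _ Xv Zv; rewrite (persp_obj_fenchel p (pos _ Zv)).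
  have := fenchel_lagr_convex p s u t01.
  rewrite -/v (fenchel_lagr_grad (pos _ Zs)).
  have resK : tau * \sum_i (v.1 i 0 - p i 0 / 2 * v.2 i 0) ^+ 2 / v.2 i 0
      <= t ^+ 2 * K.
    rewrite /K mulrCA ler_pM2l// mulr_sumr; apply: ler_sum => i _.
    have -> : v.1 i 0 - p i 0 / 2 * v.2 i 0 = t * r i.
      rewrite /r /v /segment_pt /p !mxE; field.
      by rewrite gt_eqF// pos.
    rewrite exprMn -mulrA ler_wpM2l ?sqr_ge0// ler_wpM2l ?sqr_ge0//.
    by rewrite lef_pV2 ?posrE ?pos//; exact: Zv.2.
  move=> conv opt.
  have : t * persp_obj s <= t * (fenchel_lagr Q c tau p u + t * K) by lra.
  by rewrite ler_pM2l.
apply/ler_addgt0Pr => eps eps0.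
have [t t01 tK] : exists2 t, 0 < t <= 1 & t * K <= eps.
  exists (eps / (eps + K)); last first.
    by rewrite mulrAC ler_pdivrMr; [rewrite ler_pM2l//; lra|lra].
  by rewrite divr_gt0 ?ler_pdivrMr /=; lra.
by apply: le_trans (step _ t01) _; rewrite lerD2l.
Qed.

Lemma fenchel_lagr_sep (p : 'cV[R]_n) (s : 'cV[R]_n * 'cV[R]_n) :
  fenchel_lagr Q c tau p s = quad_obj Q c s.1
    + tau * (\sum_i p i 0 * s.1 i 0) - \sum_i score tau p i * s.2 i 0.
Proof.
rewrite /fenchel_lagr /score /=; move: (quad_obj _ _ _) => q.
rewrite -addrA; congr (_ + _); rewrite sumrB mulrBr; congr (_ - _).
by rewrite mulr_sumr; apply: eq_bigr => i _; field.
Qed.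

(** The dual vector comes from the minimizer s over z_i >= e.  Testing its
optimality at (s.1, z') with z' = (1 - t) z + t kappa / n bounds
sum_i delta_i z'_i by tau times the perspective sum of s, hence by a constant C
that does not depend on t; passing from z' back to z costs at most 2 t C. *)
Lemma duality_gap_le (kappa : nat) (eps : R) :
  (0 < kappa <= n)%N -> Xset A b W h !=set0 -> 0 < eps ->
  exists p, (min_value (feasR A b W h kappa) (objR Q c tau)
    <= dual_obj Q c tau A b W h kappa p + eps%:E)%E.
Proof.
case/andP=> k0 kn [x0 Xx0] eps0.
have n0 : 0 < n%:R :> R by rewrite ltr0n (leq_trans k0).
pose a : R := kappa%:R / n%:R.
have a0 : 0 < a by rewrite divr_gt0 // ltr0n.
have a1 : a <= 1 by rewrite ler_pdivrMr// mul1r ler_nat.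
pose zc : 'cV[R]_n := const_mx a.
have Zzc : Zset kappa zc.
  split=> [i|]; first by rewrite mxE (ltW a0).
  under eq_bigr do rewrite mxE.
  by rewrite sumr_const card_ord -[_ *+ _]mulr_natr divfK ?gt_eqF.
(* (x0, zc) lies above every floor e used below, so by [persp_obj_lower] C
   bounds tau times the perspective sum of each minimizer. *)
pose C := 2 * (persp_obj (x0, zc) + \sum_i c i 0 ^+ 2 / (2 * tau)).
have C0 : 0 <= C.
  have zc01 i : 0 < (x0, zc).2 i 0 <= 1 by rewrite mxE a0.
  have := persp_obj_lower zc01.
  have : 0 <= tau / 2 * (\sum_i x0 i 0 ^+ 2 / zc i 0).
    apply: mulr_ge0; first by rewrite divr_ge0 ?ltW.
    by apply: sumr_ge0 => i _; rewrite mxE divr_ge0 ?sqr_ge0 ?ltW.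
  by rewrite /C /=; lra.
have eC : 0 < eps + C by lra.
pose t := eps / (2 * (eps + C)).
have t0 : 0 < t by rewrite divr_gt0// mulr_gt0.
have t2 : t <= 2^-1.
  by rewrite ler_pdivrMr ?mulr_gt0//; lra.
have tC : 2 * t * C <= eps.
  have -> : 2 * t * C = eps * C / (eps + C) by
    rewrite /t; field; rewrite gt_eqF.
  by rewrite ler_pdivrMr// ler_pM2l//; lra.
pose e := t * a.
have e0 : 0 < e by rewrite mulr_gt0.
have Fzc : Zfloor kappa e zc by split=> // i; rewrite mxE /e; nra.
have [s [Xs Zs smin]] := @persp_obj_minimizer kappa e (x0, zc) e0 Xx0 Fzc.
have pos i : 0 < s.2 i 0 by exact: lt_le_trans (Zs.2 i).
set p := grad_persp s.
have lagrs : fenchel_lagr Q c tau p s = persp_obj s := fenchel_lagr_grad pos.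
have lagr_min u := @fenchel_lagr_minimizer kappa e s u e0 Xs Zs smin.
have sC : \sum_i score tau p i * s.2 i 0 <= C.
  have -> : \sum_i score tau p i * s.2 i 0 =
      tau * \sum_i s.1 i 0 ^+ 2 / s.2 i 0.
    rewrite mulr_sumr; apply: eq_bigr => i _; rewrite /score mxE.
    by field; rewrite gt_eqF.
  have s01 i : 0 < s.2 i 0 <= 1 by rewrite pos; have /andP[] := Zs.1.1 i.
  have := smin (x0, zc) Xx0 Fzc; have := persp_obj_lower s01; rewrite /C; lra.
exists p.
apply: (@le_trans _ _ (persp_obj s)%:E).
  rewrite -objR_persp_obj//; apply: ereal_inf_lbound; exists s => //.
  by split => //; exact: Zs.1.
rewrite -leeBlDr// -EFinB; apply: le_ereal_inf_tmp => _ [[x z] [/= Xx Zz] <-].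
rewrite lee_fin.
pose z' := segment_pt t z zc.
have Zz' : Zfloor kappa e z'.
  split; first by apply: Zset_convex => //; lra.
  move=> i; rewrite !mxE /e; have /andP[] := Zz.1 i; nra.
have := lagr_min (x, z') Xx Zz'; have := lagr_min (s.1, z') Xs Zz'.
rewrite -lagrs !fenchel_lagr_sep /=.
(* Since t <= 1/2, z <= 2 z' and so z - z' <= t z <= 2 t z'. *)
have : \sum_i score tau p i * z i 0 <= \sum_i score tau p i * z' i 0
    + 2 * t * \sum_i score tau p i * z' i 0.
  rewrite mulr_sumr -big_split/=; apply: ler_sum => i _.
  have d0 : 0 <= score tau p i.
    by rewrite mulr_ge0 ?sqr_ge0// divr_ge0// ltW.
  suff : 0 <= score tau p i * (z' i 0 + 2 * t * z' i 0 - z i 0).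
    by rewrite mulrBr mulrDr mulrCA; lra.
  apply: mulr_ge0 => //; rewrite !mxE; have /andP[zi0 _] := Zz.1 i.
  have -> : (1 - t) * z i 0 + t * a + 2 * t * ((1 - t) * z i 0 + t * a) - z i 0
    = t * (1 - 2 * t) * z i 0 + (1 + 2 * t) * (t * a) by ring.
  have := mulr_ge0 (ltW t0) (ltW a0) => ta0.
  by apply: addr_ge0; apply: mulr_ge0 => //; [apply: mulr_ge0|]; lra.
set D' := \sum_i _ * z' i 0; set D := \sum_i _ * z i 0.
set Ds := \sum_i _ * s.2 i 0 in sC *.
move=> DD' opts optx.
have : t * D' <= t * C by rewrite ler_pM2l//; lra.
lra.
Qed.

Lemma strong_duality (kappa : nat) (p : 'cV[R]_n) :
  (0 < kappa <= n)%N -> Xset A b W h !=set0 ->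
  is_maximizer setT (dual_obj Q c tau A b W h kappa) p ->
  (min_value (feasR A b W h kappa) (objR Q c tau)
    <= dual_obj Q c tau A b W h kappa p)%E.
Proof.
move=> kn X0 [_ pmax]; apply/lee_addgt0Pr => eps eps0.
have [q qle] := duality_gap_le kn X0 eps0.
by apply: le_trans qle _; apply: leeD2r; exact: pmax.
Qed.

(** * Screening *)

(** The dual value is at most the Lagrangian at (x, indicator of S), which is
the Lagrangian at (x, z) minus the loss measured by [knapsack_gap]. *)
Lemma dual_screening_gap (kappa : nat) (p : 'cV[R]_n) (S : {set 'I_n}) (th : R)
    (s : 'cV[R]_n * 'cV[R]_n) :
  #|S| = kappa -> 0 <= th ->
  (forall j, j \in S -> th <= score tau p j) ->
  (forall j, j \notin S -> score tau p j <= th) ->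
  feasP A b W h kappa s ->
  forall i, (dual_obj Q c tau A b W h kappa p <=
    (quad_obj Q c s.1 + tau * (\sum_i s.1 i 0 ^+ 2)
     - `|score tau p i - th| * `|(i \in S)%:R - s.2 i 0|)%:E)%E.
Proof.
move=> Sk th0 thS thNS Ps i; have [Xs zk _ z01] := Ps.
pose z : 'cV[R]_n := \col_j (j \in S)%:R.
have zE (f : 'I_n -> R) : \sum_j f j * z j 0 = \sum_(j in S) f j.
  rewrite [RHS]big_mkcond; apply: eq_bigr => j _.
  by rewrite mxE; case: ifP; rewrite ?mulr1 ?mulr0.
have Zz : Zset kappa z.
  split=> [j|]; first by rewrite mxE; case: (j \in S); rewrite lexx ler01.
  have := zE (fun=> 1); under eq_bigr do rewrite mul1r.
  by move=> ->; rewrite sumr_const Sk.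
apply: (@le_trans _ _ (fenchel_lagr Q c tau p (s.1, z))%:E).
  by apply: ereal_inf_lbound; exists (s.1, z).
rewrite lee_fin.
have := fenchel_lagr_objP p Ps.
rewrite !fenchel_lagr_sep /= zE.
have s01 j : 0 <= s.2 j 0 <= 1 by case: (z01 j) => ->; rewrite lexx ler01.
rewrite -Sk in zk; have := knapsack_gap th0 thS thNS s01 zk i; lra.
Qed.

End Relaxation.

Lemma card_perm_initial n (kappa : nat) (sigma : {perm 'I_n}) :
  (kappa <= n)%N ->
  #|sigma @: finset (fun j : 'I_n => (j < kappa)%N)| = kappa.
Proof.
move=> kn; rewrite card_imset; last exact: perm_inj.
rewrite -sum1_card (eq_bigl (fun j : 'I_n => (j < kappa)%N)).
  by rewrite -(big_ord_widen _ (fun=> 1%N) kn) sum1_card card_ord.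
by move=> j; rewrite inE.
Qed.

Theorem proposition1 (R : realType) (n m1 m2 kappa : nat)
  (kappa_gt0 : (1 <= kappa)%N) (kappa_ltn : (kappa < n)%N)
  (Q : 'M[R]_n) (c : 'cV[R]_n) (tau : R)
  (A : 'M[R]_(m1, n)) (b : 'cV[R]_m1) (W : 'M[R]_(m2, n)) (h : 'cV[R]_m2)
  (fUB : R) (p : 'cV[R]_n) (sigma : {perm 'I_n}) :
  let fLB := min_value (feasR A b W h kappa) (objR Q c tau) in
  let delta := score tau p in
  sym_psd Q ->
  0 < tau ->
  feasR A b W h kappa !=set0 ->
  (min_value (feasP A b W h kappa) (objP Q c tau) <= fUB%:E)%E ->
  is_maximizer setT (dual_obj Q c tau A b W h kappa) p ->
  (forall j k : 'I_n, (j <= k)%N -> delta (sigma k) <= delta (sigma j)) ->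
  forall s : 'cV[R]_n * 'cV[R]_n,
    is_minimizer (feasP A b W h kappa) (objP Q c tau) s ->
    (forall i, screen0 kappa_ltn sigma delta fLB fUB i -> s.2 i 0 = 0) /\
    (forall i, screen1 kappa_ltn sigma delta fLB fUB i -> s.2 i 0 = 1).
Proof.
move=> fLB delta Qpsd tau0 [[x0 z0] [X0 _]] leUB pmax dsort s [Ps smin].
have kn : (0 < kappa <= n)%N by rewrite kappa_gt0 ltnW.
have sUB : quad_obj Q c s.1 + tau * (\sum_i s.1 i 0 ^+ 2) <= fUB.
  rewrite -lee_fin; apply: le_trans leUB.
  by apply: le_ereal_inf_tmp => _ [u Pu <-]; exact: smin.
have strong := strong_duality Qpsd tau0 kn (ex_intro _ x0 X0) pmax.
pose S := sigma @: finset (fun j : 'I_n => (j < kappa)%N).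
have memS j : (sigma j \in S) = (j < kappa)%N.
  by rewrite mem_imset ?inE//; exact: perm_inj.
have topS i : top_set kappa sigma i <-> i \in S.
  split=> [[j jk <-]|]; first by rewrite memS.
  by move=> /imsetP[j]; rewrite inE => jk ->; exists j.
(* Both screening rules follow from this estimate, with th at either end of the
   interval of thresholds separating the top kappa scores from the rest. *)
have gap th i : delta (sigma (pos_next kappa_ltn)) <= th ->
    th <= delta (sigma (pos_last kappa_ltn)) ->
    (fLB <= (fUB - `|delta i - th| * `|(i \in S)%:R - s.2 i 0|)%:E)%E.
  move=> nextth thlast; apply: le_trans strong _.
  have th0 : 0 <= th.
    apply: le_trans nextth.
    by rewrite mulr_ge0 ?sqr_ge0// divr_ge0// ltW.
  have thS j : j \in S -> th <= delta j.
    move=> /imsetP[k]; rewrite inE => kk ->.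
    by apply: le_trans thlast (dsort _ _ _); rewrite /= -ltnS prednK.
  have thNS j : j \notin S -> delta j <= th.
    rewrite -[j](permKV sigma) memS -leqNgt => kj.
    by apply: le_trans (dsort _ _ _) nextth.
  have Sk : #|S| = kappa by exact: card_perm_initial (ltnW kappa_ltn).
  apply: le_trans (dual_screening_gap Q c tau0 Sk th0 thS thNS Ps i) _.
  by rewrite lee_fin lerB.
have ord :
  delta (sigma (pos_next kappa_ltn)) <= delta (sigma (pos_last kappa_ltn)).
  by apply: dsort; exact: leq_pred.
have [_ _ _ z01] := Ps; split=> i [iS].
- rewrite -EFinN; set th := delta _ => lt0.
  case: (z01 i) => // zi1; exfalso; move: lt0; apply/negP; rewrite -leNgt.
  have iNS : i \notin S by apply/negP => /topS.
  have := gap th i ord (lexx _).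
  rewrite zi1 (negbTE iNS) sub0r normrN normr1 mulr1.
  move=> /(leeD2r (th%:E)) /(leeD2r (- delta i)%:E) /le_trans; apply.
  rewrite -!EFinD lee_fin; have := ler_norm (- (delta i - th)).
  rewrite normrN; lra.
- rewrite -EFinN; set th := delta (sigma _) => lt0.
  case: (z01 i) => // zi0; exfalso; move: lt0; apply/negP; rewrite -leNgt.
  move/topS: iS => iS.
  have := gap th i (lexx _) ord; rewrite zi0 iS subr0 normr1 mulr1.
  move=> /(leeD2r (delta i)%:E) /(leeD2r (- th)%:E) /le_trans; apply.
  rewrite -!EFinD lee_fin; have := ler_norm (delta i - th); lra.
Qed.
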